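(* Let $\lambda,\mu,\nu\vdash n$ with $\ell(\lambda)=\ell$, $\ell(\mu)=m$, $\ell(\nu)=r$. Then $$g(\lambda,\mu,\nu)\;\le\;\left(1+\frac{\ell m r}{n}\right)^{n}\left(1+\frac{\ell m}{n}\right)^{n}\left(1+\frac{n}{\ell m r}\right)^{\ell m r}\left(1+\frac{n}{\ell m}\right)^{\ell m}.$$
   Context: $\ell(\lambda)$ is the number of parts of $\lambda$. The Kronecker coefficient is $g(\lambda,\mu,\nu)=\frac{1}{n!}\sum_{\sigma\in S_n}\chi^\lambda(\sigma)\chi^\mu(\sigma)\chi^\nu(\sigma)$, with $\chi^\lambda$ the irreducible $S_n$-character indexed by $\lambda$. *)

(* Defs.v *)
From HB Require Import structures.
From mathcomp Require Import all_boot all_order all_fingroup all_algebra.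
From mathcomp Require Import all_solvable all_field all_character.

Set Implicit Arguments.
Unset Strict Implicit.
Unset Printing Implicit Defensive.

Import Order.TTheory GRing.Theory Num.Theory.
Local Open Scope ring_scope.

(* A partition is its weakly decreasing list of positive parts, so that its   *)
(* number of parts is the size of the list.                                   *)
Definition is_partition (n : nat) (la : seq nat) : bool :=
  [&& sorted geq la, 0%N \notin la & sumn la == n].

Section Specht.

Variables (n : nat) (la : seq nat).

(* The Young diagram of la is filled row by row with 0, ..., n-1; the entry x *)
(* then lies in row reshape_index la x and in column reshape_offset la x.     *)
Definition row_stab : {set 'S_n} :=
  [set s : 'S_n | [forall x, reshape_index la (s x) == reshape_index la x]].

Definition col_stab : {set 'S_n} :=
  [set s : 'S_n | [forall x, reshape_offset la (s x) == reshape_offset la x]].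

(* The Young symmetrizer \sum_(p, q) sgn(q) p q of this tableau, as a vector  *)
(* of the regular representation, whose basis vector for the group element s  *)
(* is delta_mx 0 (gring_index _ s).                                           *)
Definition young_symmetrizer : 'rV[algC]_#|[set: 'S_n]| :=
  \sum_(p in row_stab) \sum_(q in col_stab)
     (-1) ^+ odd_perm q *: delta_mx 0 (gring_index [set: 'S_n]%G (p * q)%g).

(* The Specht module is the ideal of the group algebra generated by the Young *)
(* symmetrizer. It is a right ideal because representations act on the right  *)
(* here; as (s * t) x = t (s x) for permutations, it is the usual left ideal  *)
(* for the opposite composition order.                                        *)
Definition specht_repr :=
  submod_repr (cyclic_mx_module (regular_repr algC [set: 'S_n]%G)
                                young_symmetrizer).

Definition irr_char : 'CF([set: 'S_n]) := cfRepr specht_repr.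

End Specht.

Definition kronecker (n : nat) (la mu nu : seq nat) : algC :=
  (n`!%:R)^-1 *
  \sum_(s : 'S_n) irr_char n la s * irr_char n mu s * irr_char n nu s.

(* Main.v *)
(* Let 'S_n act on the words of length n over a finite alphabet T. The Young  *)
(* symmetrizer factors as a b with a the sum over the row stabilizer, which   *)
(* is the stabilizer of the word w0 recording the row of each entry. Hence    *)
(* the Specht module lies in the right ideal of a, and this ideal embeds in   *)
(* the permutation module on words over size la letters through g |-> w0 g:   *)
(* the composite of this map with its transpose is left multiplication by a,  *)
(* and a ^ 2 = #|row_stab| a. The Kronecker coefficient is therefore at most  *)
(* the multiplicity of the trivial character in a product of three word       *)
(* characters, that is, by Burnside's lemma, the number of orbits of words    *)
(* over an alphabet with k = l m r letters. Orbits are multisets, so there    *)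
(* are at most 'C(n + k, n) of them, and this is at most                      *)
(* (n + k) ^ (n + k) / (n ^ n * k ^ k); the two other factors are at least 1. *)

Require Import Defs.
From mathcomp Require Import all_boot all_order all_fingroup all_algebra.
From mathcomp Require Import all_solvable all_field all_character.

Set Implicit Arguments.
Unset Strict Implicit.
Unset Printing Implicit Defensive.

Import Order.TTheory GRing.Theory Num.Theory.
Local Open Scope ring_scope.

(** The point is to replace each irreducible character by a larger permutation character whose
    products are easy to count. [irr_char_word_subr_char] embeds the Specht module of [la] in the
    module of words over [size la] letters, so the word character minus the irreducible one is again
    a character. Multiplying three word characters gives the word character of the product alphabet
    ([card_word_fix_prod]), and pairing it with the trivial character counts orbits, which
    [card_word_orbits] bounds by a binomial coefficient. [bin_le_pow] turns this into two factors of
    the stated bound; the other two are at least 1. *)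

(** The image of [B] is a submodule isomorphic to [rG1]; the difference is the character of a
    Maschke complement. *)
Lemma cfRepr_subr_char (gT : finGroupType) (G : {group gT}) (n1 n2 : nat)
    (rG1 : mx_representation algC G n1) (rG2 : mx_representation algC G n2)
    (B : 'M_(n1, n2)) :
    row_free B -> {in G, forall x, rG1 x *m B = B *m rG2 x} ->
  cfRepr rG2 - cfRepr rG1 \is a character.
Proof.
move=> freeB homB; pose U := <<B>>%MS.
have sBU : (B <= U)%MS by rewrite genmxE.
have modU : mxmodule rG2 U.
  apply/mxmoduleP=> x Gx; rewrite (eqmxMr _ (genmxE _)) genmxE -homB //.
  exact: submxMl.
have simU : mx_rsim rG1 (submod_repr modU).
  exists (in_submod U B) => [||x Gx].
  - by rewrite genmxE (eqP freeB).
  - by rewrite -row_leq_rank -{1}(eqP freeB) -{1}(in_submodK sBU) mxrankM_maxl.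
  by rewrite -in_submodJ // -homB // [LHS]mulmxA.
have [V modV defV dxV] :=
  mx_Maschke_pchar rG2 (algC'G_pchar G) modU (submx1 U).
suff -> : cfRepr rG2 = cfRepr rG1 + cfRepr (submod_repr modV).
  by rewrite addrAC subrr add0r cfRepr_char.
rewrite (cfRepr_sim simU); apply/cfun_inP=> x Gx; rewrite !cfunE Gx !mulr1n.
rewrite (mxtrace_dadd_mod modU modV (mxmodule1 rG2)) //.
by rewrite mxtrace_submod1.
Qed.

(** * Permutation modules and right ideals fixed up to scale by a stabilizer sum *)

Section PermutationRepresentation.

Variables (gT : finGroupType) (G : {group gT}) (T : finType).
Variable to : {action gT &-> T}.

Definition act_mx x : 'M[algC]_#|T| :=
  \matrix_i delta_mx 0 (enum_rank (to (enum_val i) x)).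

Lemma mul_delta_act_mx t x :
  delta_mx 0 (enum_rank t) *m act_mx x
  = delta_mx 0 (enum_rank (to t x)) :> 'rV_#|T|.
Proof. by rewrite -rowE rowK enum_rankK. Qed.

Lemma act_mx_repr : mx_repr G act_mx.
Proof.
split=> [|x y _ _]; apply/row_matrixP=> i; rewrite ?row_mul !rowK.
  by rewrite act1 enum_valK row1.
by rewrite mul_delta_act_mx actM.
Qed.
Definition act_repr := MxRepresentation act_mx_repr.

Lemma cfRepr_act x :
  x \in G -> cfRepr act_repr x = #|[set t | to t x == t]|%:R.
Proof.
move=> Gx; rewrite cfunE Gx mulr1n /mxtrace -sum1dep_card natr_sum.
rewrite [RHS]big_mkcond (reindex (@enum_val T predT)) /=; last first.
  by exists enum_rank => i _; rewrite ?enum_valK ?enum_rankK.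
apply: eq_bigr => i _; rewrite !mxE /= -(inj_eq enum_val_inj) enum_rankK eq_sym.
by case: eqP.
Qed.

Variable t0 : T.

Definition orbit_mx : 'M[algC]_(#|G|, #|T|) :=
  \matrix_i delta_mx 0 (enum_rank (to t0 (enum_val i))).

Lemma orbit_mx_hom :
  {in G, forall x, regular_repr algC G x *m orbit_mx = orbit_mx *m act_mx x}.
Proof.
move=> x Gx; apply/row_matrixP=> i; rewrite !row_mul !rowK mul_delta_act_mx.
by rewrite -rowE rowK gring_indexK ?groupM ?enum_valP // actM.
Qed.

(** Left multiplication by the sum of the stabilizer of [t0]; it commutes with the right regular
    action. *)
Definition stab_mx : 'M[algC]_#|G| :=
  \matrix_i \sum_(p in 'C_G[t0 | to]%g)
     delta_mx 0 (gring_index G (p * enum_val i)%g).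

Lemma mul_delta_stab_mx g : g \in G ->
  delta_mx 0 (gring_index G g) *m stab_mx
  = \sum_(p in 'C_G[t0 | to]%g) delta_mx 0 (gring_index G (p * g)%g)
  :> 'rV_#|G|.
Proof.
move=> Gg; rewrite -rowE rowK; apply: eq_bigr => p _.
by rewrite gring_indexK.
Qed.

Lemma stab_mx_hom :
  {in G, forall x, regular_repr algC G x *m stab_mx
                   = stab_mx *m regular_repr algC G x}.
Proof.
move=> x Gx; apply/row_matrixP=> i; rewrite !row_mul !rowK.
rewrite mul_delta_stab_mx ?groupM ?enum_valP // mulmx_suml.
apply: eq_bigr => p /setIP[Gp _].
by rewrite -rowE rowK gring_indexK ?groupM ?enum_valP // mulgA.
Qed.

Lemma orbit_mx_factor : exists H, stab_mx = orbit_mx *m H.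
Proof.
(* The witness is the transpose of [orbit_mx]: the elements sending [t0] where [g] does form the
   coset of the stabilizer through [g]. *)
exists (\matrix_j \sum_(g in G | to t0 g == enum_val j)
           delta_mx 0 (gring_index G g)).
apply/row_matrixP=> i; rewrite row_mul !rowK -rowE rowK enum_rankK.
have Gi : enum_val i \in G by apply: enum_valP.
rewrite [RHS](reindex_inj (mulIg (enum_val i))) /=.
apply: eq_bigl => p; rewrite groupMr // !inE; case: (p \in G) => //=.
rewrite sub1set inE actM; apply/eqP/eqP=> [-> // |].
by move/(congr1 (to^~ (enum_val i)^-1%g)); rewrite !actK.
Qed.

(** Since [stab_mx] commutes with the action, it is the scalar [c] on the whole module generated by
    [u]. It factors through [orbit_mx], which is therefore injective on that module. *)
Lemma cyclic_act_subr_char (u : 'rV_#|G|) (c : algC) :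
    c != 0 -> u *m stab_mx = c *: u ->
  cfRepr act_repr -
    cfRepr (submod_repr (cyclic_mx_module (regular_repr algC G) u))
    \is a character.
Proof.
move=> c0 uS; set modU := cyclic_mx_module _ _.
set U := cyclic_mx _ _ in modU *; pose B : 'M_(\rank U, _) := val_submod 1%:M.
have BS : B *m stab_mx = c *: B.
  apply/row_matrixP=> i; rewrite row_mul linearZ /=.
  have : (row i B <= U)%MS by rewrite -(val_submod1 U) row_sub.
  case/cyclic_mxP=> A /envelop_mxP[a ->] ->.
  rewrite -mulmxA mulmx_suml (_ : \sum_(x in G) _ =
    stab_mx *m \sum_(x in G) a x *: regular_repr algC G x).
    by rewrite mulmxA uS scalemxAl.
  rewrite mulmx_sumr; apply: eq_bigr => x Gx.
  by rewrite -scalemxAl -scalemxAr stab_mx_hom.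
apply: (@cfRepr_subr_char _ _ _ _ _ _ (B *m orbit_mx)).
  have [H defS] := orbit_mx_factor.
  rewrite -row_leq_rank -{1}(val_submod1 U) -(mxrank_scale_nz _ c0).
  by rewrite -/B -BS defS mulmxA mxrankM_maxl.
move=> x Gx; have := val_submodJ modU 1%:M Gx.
rewrite mul1mx val_submodE -/B => BJ.
by rewrite mulmxA BJ -!mulmxA orbit_mx_hom.
Qed.

End PermutationRepresentation.

(** * Words under permutation of positions: orbits and fixed points *)

Section Words.

Variables (n : nat) (T : finType).

Definition word_act (w : n.-tuple T) (s : 'S_n) : n.-tuple T :=
  [tuple tnth w (s^-1%g i) | i < n].

Lemma word_act_is_action : is_action [set: 'S_n] word_act.
Proof.
apply: is_total_action => [w | w s t]; apply: eq_from_tnth => i.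
  by rewrite tnth_mktuple invg1 perm1.
by rewrite !tnth_mktuple invMg permM.
Qed.
Canonical word_action := Action word_act_is_action.

Lemma word_act_perm_eq (w w' : n.-tuple T) :
  perm_eq w w' -> w \in orbit word_action [set: 'S_n] w'.
Proof.
case/tuple_permP=> p def_w; apply/orbitP; exists p^-1%g; first by rewrite inE.
by apply: val_inj; rewrite /= def_w /= invgK.
Qed.

Lemma card_word_orbits :
  (#|orbit word_action [set: 'S_n] @: [set: n.-tuple T]| <= 'C(n + #|T|, n))%N.
Proof.
(* One spare letter is added to match [card_sorted_tuples], which needs a nonempty alphabet; this
   also covers an empty [T]. *)
pose f (x : T) : 'I_#|T|.+1 := widen_ord (leqnSn _) (enum_rank x).
have inj_f : injective f.
  by move=> x y /(congr1 val) eq_xy; apply/enum_rank_inj/val_inj.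
pose ler := [rel i j : 'I_#|T|.+1 | (i <= j)%N].
pose sort_word (w : n.-tuple T) := [tuple of sort ler (map_tuple f w)].
rewrite -card_sorted_tuples.
have inj_sort w w' : sort_word w = sort_word w' ->
  orbit word_action [set: 'S_n] w = orbit word_action [set: 'S_n] w'.
  move=> /(congr1 val)/= eq_ww'; apply/orbit_eqP/word_act_perm_eq.
  by apply: (perm_map_inj inj_f); rewrite -(perm_sort ler) eq_ww' perm_sort.
(* An orbit is recovered from its sorted word; sorted tuples that come from no word are sent to
   [set0]. *)
pose orb_of t :=
  if [pick w | sort_word w == t] is Some w
  then orbit word_action [set: 'S_n] w else set0.
apply: leq_trans (leq_imset_card orb_of _); apply/subset_leq_card/subsetP=> A.
case/imsetP=> w _ ->; apply/imsetP; exists (sort_word w).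
  rewrite inE sorted_map; apply: sort_sorted => i j; exact: leq_total.
rewrite /orb_of; case: pickP => [w' /eqP/inj_sort // | /(_ w)].
by rewrite eqxx.
Qed.

End Words.

Lemma card_word_fix_prod (n : nat) (T1 T2 : finType) (s : 'S_n) :
  #|[set w | word_action n (T1 * T2)%type w s == w]| =
  (#|[set w | word_action n T1 w s == w]| *
   #|[set w | word_action n T2 w s == w]|)%N.
Proof.
pose zip_word (w : n.-tuple T1 * n.-tuple T2) : n.-tuple (T1 * T2) :=
  [tuple (tnth w.1 i, tnth w.2 i) | i < n].
have inj_zip : injective zip_word.
  move=> [u1 u2] [v1 v2] eq_uv.
  have eq_tnth i : (tnth u1 i, tnth u2 i) = (tnth v1 i, tnth v2 i).
    have : tnth (zip_word (u1, u2)) i = tnth (zip_word (v1, v2)) i.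
      by rewrite eq_uv.
    by rewrite !tnth_mktuple.
  by congr (_, _); apply: eq_from_tnth => i; case: (eq_tnth i).
rewrite -cardsX -(card_imset _ inj_zip); apply: eq_card => w.
rewrite inE; apply/eqP/imsetP=> [fix_w | [[u1 u2] /setXP[]]].
  exists ([tuple (tnth w i).1 | i < n], [tuple (tnth w i).2 | i < n]);
    last first.
    apply: eq_from_tnth => i; rewrite !tnth_mktuple /=.
    exact: surjective_pairing.
  by rewrite !inE /=; apply/andP; split; apply/eqP/eq_from_tnth => i;
    rewrite !tnth_mktuple -{2}fix_w tnth_mktuple.
rewrite !inE => fix1 fix2 ->; apply: eq_from_tnth => i.
rewrite !tnth_mktuple /= -{2}(eqP fix1) -{2}(eqP fix2).
by rewrite [tnth (word_action _ _ u1 s) i]tnth_mktuple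
           [tnth (word_action _ _ u2 s) i]tnth_mktuple.
Qed.

(** * From word modules to Specht modules and Kronecker coefficients *)

Lemma irr_char_word_subr_char (n : nat) (la : seq nat) : sumn la = n ->
  cfRepr (act_repr [set: 'S_n]%G (word_action n 'I_(size la)))
    - Defs.irr_char n la \is a character.
Proof.
move=> sum_la.
have row_lt (x : 'I_n) : (reshape_index la x < size la)%N.
  by rewrite reshape_indexP // sum_la.
pose w0 : n.-tuple 'I_(size la) := [tuple Ordinal (row_lt x) | x < n].
have stabE :
    'C_([set: 'S_n])[w0 | word_action n 'I_(size la)]%g = row_stab n la.
  apply/setP=> s; rewrite !inE sub1set inE /=.
  apply/eqP/forallP=> [fix_s x | fix_s].
    have := congr1 (fun w => val (tnth w (s x))) fix_s.
    by rewrite !tnth_mktuple permK /= => ->.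
  apply: eq_from_tnth => x; apply: val_inj; rewrite !tnth_mktuple /=.
  by have /eqP := fix_s (s^-1%g x); rewrite permKV.
have rowM p : p \in row_stab n la ->
    forall q, ((p * q)%g \in row_stab n la) = (q \in row_stab n la).
  by rewrite -stabE => Rp q; rewrite groupMl.
apply: (@cyclic_act_subr_char _ _ _ _ w0 _ #|row_stab n la|%:R).
  by rewrite pnatr_eq0 -lt0n -stabE cardG_gt0.
(* Left multiplication by each row permutation [p'] only reindexes the sum over [p], so the
   symmetrizer is an eigenvector with eigenvalue [#|row_stab n la|]. *)
rewrite /young_symmetrizer mulmx_suml scaler_nat -sumr_const.
under eq_bigr => p _.
  rewrite mulmx_suml.
  under eq_bigr => q _ do
    rewrite -scalemxAl mul_delta_stab_mx ?inE // stabE scaler_sumr.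
  rewrite exchange_big /=; over.
rewrite exchange_big /=; apply: eq_bigr => p' Rp'.
rewrite [RHS](reindex_inj (mulgI p')) /=.
apply: eq_big => [p | p _]; first by rewrite rowM.
by apply: eq_bigr => q _; rewrite mulgA.
Qed.

(** The binomial coefficient times [n ^ n * k ^ k] is a single term in the expansion of
    [(k + n) ^ (k + n)]. If [n] or [k] is zero, both sides equal 1. *)
Lemma bin_le_pow (n k : nat) :
  'C(n + k, n)%:R <= (1 + k%:R / n%:R) ^+ n * (1 + n%:R / k%:R) ^+ k :> algC.
Proof.
have [-> | n_gt0] := posnP n.
  by rewrite bin0 mul0r addr0 expr1n mulr1.
have [-> | k_gt0] := posnP k.
  by rewrite addn0 binn mul0r addr0 expr1n mulr1.
have n0 : n%:R != 0 :> algC by rewrite pnatr_eq0 -lt0n.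
have k0 : k%:R != 0 :> algC by rewrite pnatr_eq0 -lt0n.
have -> : 1 + k%:R / n%:R = (n + k)%:R / n%:R :> algC.
  by rewrite natrD mulrDl divff.
have -> : 1 + n%:R / k%:R = (n + k)%:R / k%:R :> algC.
  by rewrite natrD mulrDl divff // addrC.
rewrite !expr_div_n mulf_div -exprD ler_pdivlMr; last first.
  by rewrite mulr_gt0 // exprn_gt0 // ltr0n.
rewrite -!natrX -!natrM ler_nat addnC expnDn.
have n_lt : (n < (k + n).+1)%N by rewrite ltnS leq_addl.
rewrite (bigD1 (Ordinal n_lt)) //= addnK [(n ^ n * _)%N]mulnC.
exact: leq_addr.
Qed.

Lemma kronecker_le_bin (n : nat) (la mu nu : seq nat) :
    sumn la = n -> sumn mu = n -> sumn nu = n ->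
  kronecker n la mu nu
    <= 'C(n + size la * size mu * size nu, n)%:R.
Proof.
move=> n_la n_mu n_nu; set k := (_ * size nu)%N.
pose M l := cfRepr (act_repr [set: 'S_n]%G (word_action n 'I_l)).
have M_char l : M l \is a character by apply: cfRepr_char.
have chi_char ka : Defs.irr_char n ka \is a character by apply: cfRepr_char.
have D_char ka : sumn ka = n ->
    M (size ka) - Defs.irr_char n ka \is a character.
  exact: irr_char_word_subr_char.
have kronE : kronecker n la mu nu =
    '[Defs.irr_char n la * Defs.irr_char n mu * Defs.irr_char n nu, 1].
  rewrite cfdotE cardsT card_Sn /kronecker; congr (_ * _).
  apply: eq_big => [s | s _]; first by rewrite inE.
  by rewrite !cfunE cfun1E inE rmorph1 mulr1.
have /le_trans-> // : kronecker n la mu nu <=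
    '[M (size la) * M (size mu) * M (size nu), 1].
  rewrite kronE -subr_ge0 -cfdotBl.
  (* Telescoping, one factor at a time, writes the difference as a sum of products of characters. *)
  have -> : M (size la) * M (size mu) * M (size nu)
      - Defs.irr_char n la * Defs.irr_char n mu * Defs.irr_char n nu
    = (M (size la) - Defs.irr_char n la) * M (size mu) * M (size nu)
      + Defs.irr_char n la * (M (size mu) - Defs.irr_char n mu) * M (size nu)
      + Defs.irr_char n la * Defs.irr_char n mu
        * (M (size nu) - Defs.irr_char n nu).
    by rewrite !(mulrBl, mulrBr) !addrA !subrK.
  apply: natr_ge0; apply: Cnat_cfdot_char; last exact: cfun1_char.
  by apply: rpredD; [apply: rpredD |]; rewrite !rpredM ?D_char ?chi_char.
pose T := ('I_(size la) * 'I_(size mu) * 'I_(size nu))%type.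
have cardT : #|{: T}| = k by rewrite !card_prod !card_ord.
have := card_word_orbits n T; rewrite cardT.
rewrite -(ler_nat algC); apply: le_trans.
have actsT : [acts [set: 'S_n]%G, on [set: n.-tuple T] | word_action n T].
  by apply/actsP=> s _ w; rewrite !inE.
(* Burnside's count: the pairing with the trivial character is the average number of fixed words
   over the alphabet [T]. *)
rewrite cfdotE ler_pdivrMl ?ltr0n ?cardG_gt0 // -natrM mulnC.
rewrite -(Frobenius_Cauchy actsT) natr_sum.
apply: ler_sum => s _; rewrite cfunE cfunE cfun1E inE rmorph1 mulr1.
rewrite !cfRepr_act ?inE // -!natrM -!card_word_fix_prod ler_nat.
apply/subset_leq_card/subsetP=> w; rewrite !inE /=.
by move/eqP=> w_fix; rewrite sub1set inE /= w_fix.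
Qed.

Theorem theorem4p6 (n l m r : nat) (la mu nu : seq nat)
    (hla : is_partition n la) (hmu : is_partition n mu)
    (hnu : is_partition n nu)
    (hl : size la = l) (hm : size mu = m) (hr : size nu = r) :
  kronecker n la mu nu <=
    (1 + (l * m * r)%:R / n%:R) ^+ n
    * (1 + (l * m)%:R / n%:R) ^+ n
    * (1 + n%:R / (l * m * r)%:R) ^+ (l * m * r)
    * (1 + n%:R / (l * m)%:R) ^+ (l * m).
Proof.
case/and3P: hla => _ _ /eqP n_la; case/and3P: hmu => _ _ /eqP n_mu.
case/and3P: hnu => _ _ /eqP n_nu.
apply: le_trans (kronecker_le_bin n_la n_mu n_nu) _; rewrite hl hm hr.
set k := (l * m * r)%N; set j := (l * m)%N.
have pow_ge1 (a b c : nat) : 1 <= (1 + a%:R / b%:R) ^+ c :> algC.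
  by rewrite exprn_ege1 // lerDl divr_ge0 ?ler0n.
apply: le_trans (bin_le_pow n k) _.
rewrite -[leRHS]mulrA [leRHS]mulrACA ler_peMr //.
  by rewrite mulr_ge0 // (le_trans ler01) ?pow_ge1.
by rewrite -[leLHS]mulr1 ler_pM ?ler01 ?pow_ge1.
Qed.
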